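(* For each integer $a\ge 0$, there exists an integer $t_1=t_1(a)$ such that for every integer $t\ge t_1$, there exists a $K_t$-minor-free graph that is not $\{1\star (t-2a-6),\,3a+6\}$-choosable.
   Context: All graphs are finite and simple. A graph is $K_t$-minor-free if $K_t$ cannot be obtained from a subgraph of it by contracting edges. A list assignment $L$ of a graph $G$ assigns to each vertex $v$ a set $L(v)$ of colours; an $L$-colouring is a proper colouring $f$ with $f(v)\in L(v)$ for all $v$. For a multiset $\lambda=\{k_1,\dots,k_q\}$ of positive integers, a $\lambda$-list assignment of $G$ is a list assignment $L$ such that the colour set $\bigcup_{v\in V(G)}L(v)$ can be partitioned into $q$ sets $C_1,\dots,C_q$ with $|L(v)\cap C_i|\ge k_i$ for every $i$ and every vertex $v$. $G$ is $\lambda$-choosable if $G$ is $L$-colourable for every $\lambda$-list assignment $L$. The notation $b\star m$ inside a multiset means $m$ copies of $b$; so $\{1\star(t-2a-6),3a+6\}$ consists of $t-2a-6$ ones and one copy of $3a+6$. *)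

(* Defs.v *)
From mathcomp Require Import all_boot.
Set Implicit Arguments.
Unset Strict Implicit.
Unset Printing Implicit Defensive.

Definition simple_graph (T : finType) (e : rel T) : Prop :=
  symmetric e /\ irreflexive e.

(* S induces a connected subgraph (S nonempty is required separately). *)
Definition connected_in (T : finType) (e : rel T) (S : {set T}) : Prop :=
  forall x y, x \in S -> y \in S ->
    connect [rel u v | [&& e u v, u \in S & v \in S]] x y.

(* G has a K_t minor: there are t pairwise disjoint, nonempty, connected
   branch sets, every two of which are joined by an edge. This is the
   standard equivalent of "K_t is obtained from a subgraph by contracting
   edges". *)
Definition has_K_minor (T : finType) (e : rel T) (t : nat) : Prop :=
  exists B : 'I_t -> {set T},
    [/\ forall i, B i != set0,
        forall i, connected_in e (B i),
        forall i j, i != j -> [disjoint B i & B j]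
      & forall i j, i != j -> exists x y, [/\ x \in B i, y \in B j & e x y]].

Definition K_minor_free (T : finType) (e : rel T) (t : nat) : Prop :=
  ~ has_K_minor e t.

(* lambda = multiset {k_1,...,k_q} given as a sequence of positive integers.
   L : T -> {set C} is a lambda-list assignment if the colours can be
   partitioned into q classes (class of colour c is part c) with
   |L(v) ∩ C_i| >= k_i for all v and i. *)
Definition lambda_list_assignment (lam : seq nat) (T : finType) (C : finType)
    (L : T -> {set C}) : Prop :=
  exists part : C -> 'I_(size lam),
    forall (v : T) (i : 'I_(size lam)),
      nth 0 lam i <= #|[set c in L v | part c == i]|.

Definition L_colourable (T : finType) (e : rel T) (C : finType)
    (L : T -> {set C}) : Prop :=
  exists f : T -> C, (forall v, f v \in L v) /\ (forall u v, e u v -> f u != f v).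

Definition lambda_choosable (lam : seq nat) (T : finType) (e : rel T) : Prop :=
  forall (C : finType) (L : T -> {set C}),
    lambda_list_assignment lam L -> L_colourable e L.

Definition lam_ones_plus (m k : nat) : seq nat := rcons (nseq m 1) k.

(* Main.v *)
(** Put [s = 2a+5], [m = t-2a-6] and [k = 3a+6].  The colours are [m] common
    ones and [k+1] big ones; every list consists of all colours but one big
    one.  Start with a clique on [t-1 = m+s] vertices: in any colouring at
    least [s] of its vertices, say [u_1, ..., u_s], get big colours.  For every
    choice of the [u_i] and their colours, and of a set [Z] of
    [z = s^2-a-3] further clique vertices, attach a new clique
    [B_1 + ... + B_s], each [B_i] of size [s], whose vertices in [B_i] see the
    old clique except [Z] and [u_i], and whose lists avoid the colour of [u_i].
    In the matching copy, the [m+3a+8] vertices of the two cliques outside [Z]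
    need distinct colours, but there are only [m+3a+7] colours.

    In a [K_t] minor some branch set lies inside one copy, so every branch set
    meets the set [V] of the old vertices outside [Z] and the vertices of that
    copy.  If some branch set meets [V] only in [u_i], let [Q = B_i]; otherwise
    let [Q = {u_1, ..., u_s}].  Then no branch set meets [V] in a single vertex
    of [Q], so [|S & V| + |S & (V \ Q)| >= 2] for all branch sets [S], and
    summing gives [2t <= 2|V| - s = 2t-1]. *)
Require Import Defs.
From mathcomp Require Import all_boot zify.

Set Implicit Arguments.
Unset Strict Implicit.
Unset Printing Implicit Defensive.

Lemma sum_card_setI_disjoint (I T : finType) (B : I -> {set T}) (V : {set T}) :
  (forall i j, i != j -> [disjoint B i & B j]) ->
  \sum_i #|B i :&: V| <= #|V|.
Proof.
move=> disB.
rewrite (eq_bigr (fun i => \sum_(x in V) (x \in B i : nat))); last first.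
  move=> i _; rewrite -sum1_card big_mkcond [RHS]big_mkcond.
  by apply: eq_bigr => x _; rewrite inE; case: (x \in B i); case: (x \in V).
rewrite exchange_big -sum1_card; apply: leq_sum => x _ /=.
case: (pickP (fun i => x \in B i)) => [i xi | noB]; last first.
  by rewrite big1 // => i _; rewrite noB.
rewrite (bigD1 i) //= xi big1 // => j ji.
by rewrite (disjointFr (disB _ _ _) xi) // eq_sym.
Qed.

Lemma connected_in_neighbour (T : finType) (e : rel T) (S : {set T}) x y :
  connected_in e S -> x \in S -> y \in S -> y != x ->
  exists2 w, w \in S & e x w.
Proof.
move=> conS xS yS yx; have /connectP[[|w q] /=] := conS _ _ xS yS.
  by move=> _ yEx; rewrite yEx eqxx in yx.
by case/andP=> /and3P[xw _ wS] _ _; exists w.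
Qed.

(* The vertices [u_i], their colours, and the set [Z]. *)
Definition attachment (p s k : nat) : finType :=
  ({ffun 'I_s -> 'I_p} * {ffun 'I_s -> 'I_k.+1} * {set 'I_p})%type.

Definition good_attachment p s k z (tau : attachment p s k) : bool :=
  [&& injectiveb tau.1.1, #|tau.2| == z & [forall i, tau.1.1 i \notin tau.2]].

(** Here [inr (tau, (i, j))] is the [j]-th vertex of the block B_i in the copy attached along
    [tau]. *)
Definition glued (p s k z : nat) : finType :=
  ('I_p + {tau : attachment p s k | good_attachment z tau} * ('I_s * 'I_s))%type.

Definition attached p s k (tau : attachment p s k) (u : 'I_p)
    (b : 'I_s * 'I_s) :=
  (u \notin tau.2) && (u != tau.1.1 b.1).

Definition glued_edge p s k z : rel (glued p s k z) := fun x y =>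
  match x, y with
  | inl u, inl v => u != v
  | inl u, inr w => attached (val w.1) u w.2
  | inr w, inl u => attached (val w.1) u w.2
  | inr w, inr w' => (w.1 == w'.1) && (w.2 != w'.2)
  end.

Lemma glued_simple p s k z : simple_graph (@glued_edge p s k z).
Proof.
split=> [[u|w] [v|w'] //= | [u|w] /=]; rewrite ?eqxx //.
  by rewrite eq_sym.
by rewrite eq_sym [w'.2 == _]eq_sym.
Qed.

Section Copy.
Variables (p s k z : nat) (tau : {tau : attachment p s k | good_attachment z tau}).

Let al := (val tau).1.1.
Let Z := (val tau).2.

(** The set V of the overview. *)
Definition copy_hull : {set glued p s k z} :=
  [set x | match x with inl u => u \notin Z | inr w => w.1 == tau end].

Lemma copy_hull_edge b y : glued_edge (inr (tau, b)) y -> y \in copy_hull.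
Proof. by case: y => [u|w] /=; rewrite inE; case/andP=> // /eqP ->. Qed.

Lemma card_copy_hull : #|copy_hull| = p - z + s * s.
Proof.
have -> : copy_hull = [set inl u | u in ~: Z] :|: [set inr (tau, b) | b in setT].
  apply/setP=> -[u|[t b]]; rewrite !inE /=.
    rewrite mem_imset ?inE; last by move=> ? ? [].
    by rewrite [X in _ || X](_ : _ = false) ?orbF //; apply/imsetP=> -[].
  rewrite [X in X || _](_ : _ = false) /=; last by apply/imsetP=> -[].
  apply/eqP/imsetP => [-> | [b' _ [-> _]] //]; by exists b.
rewrite cardsU (_ : _ :&: _ = set0) ?cards0 ?subn0; last first.
  by apply/setP=> x; rewrite !inE; apply/negP=> /andP[/imsetP[u _ ->] /imsetP[]].
rewrite !card_imset; try by move=> ? ? [].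
rewrite cardsT card_prod card_ord cardsCs setCK card_ord.
by have /and3P[_ /eqP -> _] := valP tau.
Qed.

Lemma root_inj : injective al.
Proof. by have /and3P[/injectiveP] := valP tau. Qed.

Definition roots : {set glued p s k z} := [set inl (al i) | i in 'I_s].

Definition block i : {set glued p s k z} := [set inr (tau, (i, j)) | j in 'I_s].

Lemma roots_sub : roots \subset copy_hull.
Proof.
apply/subsetP=> _ /imsetP[i _ ->]; rewrite inE.
by have /and3P[_ _ /forallP/(_ i)] := valP tau.
Qed.

Lemma block_sub i : block i \subset copy_hull.
Proof. by apply/subsetP=> _ /imsetP[j _ ->]; rewrite inE. Qed.

Lemma card_roots : #|roots| = s.
Proof. by rewrite card_imset ?card_ord // => i j [/root_inj]. Qed.

Lemma card_block i : #|block i| = s.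
Proof. by rewrite card_imset ?card_ord // => j l []. Qed.

End Copy.

Arguments copy_hull {p s k z} tau.
Arguments roots {p s k z} tau.
Arguments block {p s k z} tau i.

(** As [p < t], some branch set avoids the old clique; being connected, it lies in a single copy
    [tau]. Every other branch set contains a neighbour of it, and all neighbours of copy vertices
    lie in the hull. *)
Lemma glued_minor_hull p s k z t (B : 'I_t -> {set glued p s k z}) :
  p < t ->
  (forall i, B i != set0) ->
  (forall i, connected_in (@glued_edge p s k z) (B i)) ->
  (forall i j, i != j -> [disjoint B i & B j]) ->
  (forall i j, i != j -> exists x y, [/\ x \in B i, y \in B j & glued_edge x y]) ->
  exists tau, forall i, B i :&: copy_hull tau != set0.
Proof.
move=> ltpt nzB conB disB adjB.
pose V : {set glued p s k z} := [set inl u | u in 'I_p].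
have [i0 Bi0] : exists i, B i :&: V == set0.
  apply/existsP; apply: contraLR ltpt; rewrite negb_exists -leqNgt => /forallP nz.
  have <- : #|V| = p by rewrite card_imset ?card_ord // => ? ? [].
  apply: leq_trans (sum_card_setI_disjoint V disB).
  rewrite -[t in t <= _]card_ord -sum1_card.
  by apply: leq_sum => i _; rewrite card_gt0.
have noV u : inl u \notin B i0.
  apply/negP=> uB; have : inl u \in B i0 :&: V by rewrite inE uB imset_f.
  by rewrite (eqP Bi0) inE.
have [[u uB|[tau b] xB]] := set0Pn _ (nzB i0).
  by rewrite (negPf (noV u)) in uB.
have in_copy y : y \in B i0 -> exists b', y = inr (tau, b').
  move=> yB; have := conB _ _ _ xB yB; case/connectP=> q.
  elim: q b {xB} => [|w q IH] b /=; first by move=> _ ->; exists b.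
  case/andP=> /and3P[ew _ wB]; case: w wB ew => [u uB|[t' b'] _] /=.
    by rewrite (negPf (noV u)) in uB.
  by case/andP=> /eqP <- _; apply: IH.
exists tau => i; case: (eqVneq i i0) => [->|ii0].
  by apply/set0Pn; exists (inr (tau, b)); rewrite !inE xB /=.
have [|x [y [/in_copy[b' ->] yB /copy_hull_edge yh]]] := adjB i0 i.
  by rewrite eq_sym.
by apply/set0Pn; exists y; rewrite inE yB.
Qed.

Lemma glued_minor_free p s k z t :
  p < t -> 2 * (p - z + s * s) < 2 * t + s ->
  K_minor_free (@glued_edge p s k z) t.
Proof.
move=> ltpt ltw [B [nzB conB disB adjB]].
have [tau hull] := glued_minor_hull ltpt nzB conB disB adjB.
suff [Q [subQ cardQ noQ]] : exists Q : {set glued p s k z},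
    [/\ Q \subset copy_hull tau, #|Q| = s &
        forall i q, q \in Q -> B i :&: copy_hull tau <> [set q]].
  (* A branch set meeting the hull in one vertex is counted in both terms, since that vertex is
     outside [Q]. *)
  have : \sum_(i < t) 2 <= #|copy_hull tau| + #|copy_hull tau :\: Q|.
    apply: leq_trans (leq_add (sum_card_setI_disjoint _ disB)
                              (sum_card_setI_disjoint _ disB)).
    rewrite -big_split /=; apply: leq_sum => i _.
    have := hull i; rewrite -card_gt0 leq_eqVlt => /orP[|]; last first.
      by move=> lt1; apply: leq_trans lt1 (leq_addr _ _).
    rewrite eq_sym => /cards1P[q Eq]; rewrite setIDA Eq cards1.
    rewrite (_ : _ :\: _ = [set q]) ?cards1 //.
    apply/setP=> x; rewrite !inE; case: eqP => [->|]; rewrite ?andbF // andbT.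
    by apply/negP=> qQ; apply: noQ qQ Eq.
  rewrite cardsD (setIidPr subQ) cardQ card_copy_hull sum_nat_const card_ord.
  have := subset_leq_card subQ; rewrite cardQ card_copy_hull; lia.
case: (boolP [exists i : 'I_t, exists l : 'I_s,
    B i :&: copy_hull tau == [set inl ((val tau).1.1 l)]]).
  case/existsP=> i /existsP[l /eqP Ei]; exists (block tau l).
  split; [exact: block_sub | exact: card_block | move=> j q /imsetP[r _ ->] Ej].
  (* A vertex of block [l] has all its neighbours in the hull. So if it is the only hull vertex of
     [B j], it is all of [B j], and its edge to [B i] must end at root [l], to which block [l] is
     not joined. *)
  have bB : inr (tau, (l, r)) \in B j.
    by have := set11 (inr (tau, (l, r)) : glued p s k z); rewrite -Ej inE => /andP[].
  have ji : j != i.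
    apply/eqP=> ji; have := set11 (inr (tau, (l, r)) : glued p s k z).
    by rewrite -Ej ji Ei inE.
  have [x [y [xB yB exy]]] := adjB _ _ ji.
  have xE : x = inr (tau, (l, r)).
    apply/eqP; apply: contraT => xb.
    have [w wB ew] := connected_in_neighbour (conB j) bB xB xb.
    have : w \in B j :&: copy_hull tau by rewrite inE wB (copy_hull_edge ew).
    rewrite Ej inE => /eqP wE; by rewrite wE (glued_simple p s k z).2 in ew.
  rewrite xE in exy.
  have : y \in B i :&: copy_hull tau by rewrite inE yB (copy_hull_edge exy).
  rewrite Ei inE => /eqP yE; move: exy; rewrite yE /= /attached eqxx andbF //.
rewrite negb_exists => /forallP noroot; exists (roots tau).
split; [exact: roots_sub | exact: card_roots | move=> j q /imsetP[r _ ->] Ej].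
by have := noroot j; rewrite negb_exists => /forallP/(_ r); rewrite Ej eqxx.
Qed.

(** The big colour left out of the list; for old vertices [ord0] is an arbitrary choice. *)
Definition glued_excl p s k z (x : glued p s k z) : 'I_k.+1 :=
  match x with inl _ => ord0 | inr w => (val w.1).1.2 w.2.1 end.

Definition glued_list m p s k z (x : glued p s k z) : {set 'I_m + 'I_k.+1} :=
  [set~ inr (glued_excl x)].

Lemma glued_list_lambda m p s k z :
  lambda_list_assignment (lam_ones_plus m k) (@glued_list m p s k z).
Proof.
have szl : size (lam_ones_plus m k) = m.+1 by rewrite size_rcons size_nseq.
(* Each common colour is a class of its own; the big colours form the last class. *)
pose part (c : 'I_m + 'I_k.+1) : 'I_(size (lam_ones_plus m k)) :=
  cast_ord (esym szl)
    (match c with inl i => widen_ord (leqnSn m) i | inr _ => ord_max end).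
exists part => x i; have : i < m.+1 by rewrite -szl.
rewrite ltnS nth_rcons size_nseq nth_nseq.
case: (ltngtP i m) => // [lim _ | im _].
  rewrite card_gt0; apply/set0Pn; exists (inl (Ordinal lim)).
  by rewrite !inE; apply/eqP/val_inj.
have cardk : #|[set (inr c : 'I_m + 'I_k.+1) | c in [set~ glued_excl x]]| = k.
  rewrite card_imset; last by move=> ? ? [].
  by rewrite cardsC1 card_ord.
rewrite -[X in X <= _]cardk.
apply/subset_leq_card/subsetP=> d /imsetP[c]; rewrite inE in_set1 => cx ->.
rewrite !inE.
by apply/andP; split; [apply: contra cx => /eqP[->] | apply/eqP/val_inj].
Qed.

(** The three bounds give [s] old vertices with big colours, room for Z away from them, and more
    hull vertices than colours. *)
Lemma glued_not_colourable m p s k z :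
  m + s <= p -> s + z <= p -> m + k.+1 < p - z + s * s ->
  ~ L_colourable (@glued_edge p s k z) (@glued_list m p s k z).
Proof.
move=> msp szp lt [f [fL fe]].
have fA u v : f (inl u) = f (inl v) -> u = v.
  by move=> E; apply/eqP; apply: contraT => /(fe (inl u) (inl v)); rewrite E eqxx.
pose big (c : 'I_m + 'I_k.+1) := if c is inr _ then true else false.
pose U := [set u | big (f (inl u))].
have cardU : s <= #|U|.
  have : #|~: U| <= m.
    have sub : [set f (inl u) | u in ~: U] \subset [set inl i | i in 'I_m].
      apply/subsetP=> c /imsetP[u]; rewrite !inE => nb ->.
      by case: (f (inl u)) nb => // i _; rewrite imset_f.
    have := subset_leq_card sub.
    by rewrite !card_imset ?card_ord // => u v [].
  by have := cardsC U; rewrite card_ord; lia.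
pose al : {ffun 'I_s -> 'I_p} := [ffun i => enum_val (widen_ord cardU i)].
have al_inj : injective al.
  by move=> i j; rewrite !ffunE => /enum_val_inj/(congr1 val)/= /val_inj.
have alU i : big (f (inl (al i))).
  by have := enum_valP (widen_ord cardU i); rewrite inE ffunE.
have [Z ZC cardZ] : exists2 Z : {set 'I_p}, Z \subset ~: (al @: setT) & #|Z| = z.
  have : z <= #|~: (al @: setT)|.
    by have := cardsC (al @: setT); rewrite card_imset // cardsT !card_ord; lia.
  case/card_geqP=> q [uq <- qC]; exists [set x in q].
    by apply/subsetP=> x; rewrite inE => /qC.
  by rewrite cardsE; apply/card_uniqP.
(* Every [al i] has a big colour, so the default [ord0] is never taken. *)
pose ga : {ffun 'I_s -> 'I_k.+1} :=
  [ffun i => if f (inl (al i)) is inr c then c else ord0].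
have good : good_attachment z (al, ga, Z).
  apply/and3P; split; [exact/injectiveP | exact/eqP | apply/forallP=> i /=].
  by apply/negP=> /(subsetP ZC); rewrite inE imset_f.
pose tau : {tau : attachment p s k | good_attachment z tau} := exist _ (al, ga, Z) good.
(* The one old vertex of the hull not joined to [(tau, b)] is [al b.1], whose colour is missing from
   the list of [(tau, b)]. *)
have sep u b : u \notin Z -> f (inl u) != f (inr (tau, b)).
  move=> uZ; case: (eqVneq u (al b.1)) => [->|ub].
    have := fL (inr (tau, b)); rewrite !inE /= ffunE => ne.
    by case: (f (inl _)) (alU b.1) ne => // c _; rewrite eq_sym.
  by apply: fe; rewrite /= /attached /= uZ.
have f_inj : {in copy_hull tau &, injective f}.
  move=> x y; rewrite !inE.
  case: x => [u|[t b]]; case: y => [v|[t' b']] /=.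
  - by move=> _ _ /fA ->.
  - by move=> uZ /eqP -> E; have := sep u b' uZ; rewrite E eqxx.
  - by move=> /eqP -> vZ E; have := sep v b vZ; rewrite E eqxx.
  move=> /eqP -> /eqP -> E; congr (inr (_, _)); apply/eqP; apply: contraT => bb.
  by have := fe (inr (tau, b)) (inr (tau, b')); rewrite /= eqxx bb E eqxx => /(_ isT).
have := max_card (f @: copy_hull tau).
by rewrite card_in_imset // card_copy_hull card_sum !card_ord leqNgt lt.
Qed.

Theorem theorem2 :
  forall a : nat, exists t1 : nat, forall t : nat, t1 <= t ->
    exists (T : finType) (e : rel T),
      [/\ simple_graph e, K_minor_free e t &
          ~ lambda_choosable (lam_ones_plus (t - 2 * a - 6) (3 * a + 6)) e].
Proof.
(* With [p = t-1] the hull has t+a+2 vertices: one more than the m+k+1 = t+a+1 colours, while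
   2(t+a+2) = 2t+s-1. The bound on [t] leaves room for the [s] roots and Z in the old clique. *)
move=> a; pose s := 2 * a + 5; pose z := s * s - (a + 3).
exists (s * s + s + 1) => t let1t.
have ss : a + 3 <= s * s by rewrite /s; nia.
exists (glued t.-1 s (3 * a + 6) z), (@glued_edge _ _ _ _).
split; first exact: glued_simple.
  by apply: glued_minor_free; rewrite /z; lia.
move=> /(_ _ _ (glued_list_lambda _ _ _ _ _)).
by apply: glued_not_colourable; rewrite /z; lia.
Qed.
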